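(* Let $w$ be a driver and $b$ a bundle (a finite tuple of distinct tasks) whose tasks have 3PL costs $c_i\ge 0$, and put $\bar C=\sum_{i\in b}c_i$. Let the acceptance probability be $$P_w(b,C)=\frac{1}{1+e^{-(\alpha^w+B^wX_{wb}+D^wY_w+\gamma^wC)}},\qquad C\ge 0,$$ with $\alpha^w\in\mathbb R$, $B^w\in\mathbb R^n$, $D^w\in\mathbb R^m$, $X_{wb}\in\mathbb R^n_{\ge 0}$, $Y_w\in\mathbb R^m$ and $\gamma^w>0$. Then the optimal compensation value $C^*_{wb}=\operatorname{arg\,max}_{C\ge 0}P_w(b,C)(\bar C-C)$ offered to driver $w$ for bundle $b$ is equal to $$C^*_{wb}=\begin{cases}-\dfrac{W\!\left(e^{\alpha^w+B^wX_{wb}+D^wY_w+\gamma^w\bar C-1}\right)-\gamma^w\bar C+1}{\gamma^w}, & \text{if }\gamma^w\bar C>1+e^{\alpha^w+B^wX_{wb}+D^wY_w},\\[2mm] 0, & \text{otherwise,}\end{cases}$$ where $W(\cdot)$ is the Lambert $W$ function.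
   Context: $B^wX_{wb}$ and $D^wY_w$ denote dot products. $X_{wb}$ collects the values of bundle-dependent predictors, $Y_w$ the values of driver-only predictors. $W$ is the principal real branch of the Lambert function: for $\phi>0$, $W(\phi)$ is the unique $\eta>0$ with $\eta e^\eta=\phi$. *)

(* Defs.v *)
From HB Require Import structures.
From mathcomp Require Import all_boot all_order all_algebra.
From mathcomp Require Import all_classical all_reals all_analysis.

Set Implicit Arguments.
Unset Strict Implicit.
Unset Printing Implicit Defensive.

Import Order.TTheory GRing.Theory Num.Theory.
Import numFieldNormedType.Exports.

Local Open Scope classical_set_scope.
Local Open Scope ring_scope.

Definition dotp (R : realType) (n : nat) (u v : 'rV[R]_n) : R :=
  \sum_(i < n) u 0 i * v 0 i.

(* The principal real branch of the Lambert function on positive arguments: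
   for phi > 0 exactly one eta > 0 satisfies eta * exp eta = phi, and xget
   selects it. The value 0 returned when phi <= 0 is a default; in particular
   this is not the principal branch on [-1/e, 0[. *)
Definition lambertW (R : realType) (phi : R) : R :=
  xget 0 [set eta : R | 0 < eta /\ eta * expR eta = phi].

Definition acceptance_prob (R : realType) (n m : nat) (alpha : R)
    (B X : 'rV[R]_n) (D Y : 'rV[R]_m) (gamma C : R) : R :=
  (1 + expR (- (alpha + dotp B X + dotp D Y + gamma * C)))^-1.

Definition argmax (R : realType) (T : Type) (A : set T) (f : T -> R) : set T :=
  [set x | A x /\ forall y, A y -> f y <= f x].

(* Main.v *)
(** With [t = gamma C], [a = gamma Cbar] and [eta = W (e^(u+a-1))], the candidate
    [t0 = a - 1 - eta] satisfies [eta = e^(u+t0)], and the strict inequality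
    [(a - t) / (1 + e^(-u-t)) < eta] for [t <> t0] rearranges to
    [1 + (t0 - t) < e^(t0-t)].  When [a <= 1 + e^u], optimality of [t = 0] likewise
    reduces to [1 - t < e^(-t)]. *)
Require Import Defs.
From HB Require Import structures.
From mathcomp Require Import all_boot all_order all_algebra.
From mathcomp Require Import all_classical all_reals all_analysis.
From mathcomp Require Import ring lra.

Import Order.TTheory GRing.Theory Num.Theory.
Import numFieldNormedType.Exports.

Local Open Scope classical_set_scope.
Local Open Scope ring_scope.

Lemma argmax_set1 (R : realType) (T : Type) (A : set T) (f : T -> R) (x : T) :
  A x -> (forall y, A y -> y <> x -> f y < f x) -> argmax A f = [set x].
Proof.
move=> Ax fx; apply/seteqP; split => [y [Ay fy]|_ ->] /=.
  by apply: contrapT => /(fx _ Ay); rewrite ltNge fy.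
split=> // y Ay; have [->//|/fx-/(_ Ay)/ltW//] := pselect (y = x).
Qed.

(** Existence comes from the intermediate value theorem for [x * expR x] on [[0, phi]]: it is 0 at
    0, and at least [phi] at [phi] because [expR phi > 1]. The root is nonzero since [phi] is. *)
Lemma lambertW_spec (R : realType) (phi : R) : 0 < phi ->
  0 < lambertW phi /\ lambertW phi * expR (lambertW phi) = phi.
Proof.
move=> phi0; pose f (x : R) := x * expR x.
suff [x x0 fx] : exists2 x : R, 0 < x & f x = phi.
  exact: (xgetPex 0 (ex_intro (fun y => 0 < y /\ y * expR y = phi) x (conj x0 fx))).
have cf : {within `[0, phi], continuous f}.
  apply: continuous_subspaceT => x; apply: cvgM; first exact: cvg_id.
  exact: continuous_expR.
have f0 : f 0 = 0 by rewrite /f mul0r.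
have phi_le : phi <= f phi by rewrite ler_peMr ?ltW// expR_gt1.
have [|x /itvP xb fx] := IVT (ltW phi0) cf (v := phi).
  by rewrite f0 minElt maxElt; case: ifP; lra.
exists x => //; rewrite lt_neqAle eq_sym xb andbT.
by apply/eqP => x0; move: fx phi0; rewrite x0 f0 => <-; rewrite ltxx.
Qed.

(** A vanishing derivative in [t] means a - 1 - t = e^(u+t). Writing eta = a - 1 - t turns this into
    the hypothesis on [eta], so [t0] is the unique stationary point. *)
Lemma logistic_margin_lt_interior (R : realType) (u a t eta : R) :
  0 < eta -> eta * expR eta = expR (u + a - 1) -> t <> a - 1 - eta ->
  (1 + expR (- (u + t)))^-1 * (a - t) < eta.
Proof.
move=> eta0 etaE tN; set t0 := a - 1 - eta.
have etaV : eta = expR (u + t0).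
  rewrite (_ : u + t0 = u + a - 1 - eta); last by rewrite /t0; ring.
  by rewrite expRD -etaE -mulrA -expRD subrr expR0 mulr1.
have q0 := expR_gt0 (- (u + t)).
rewrite mulrC ltr_pdivrMr; last by lra.
(* Only the [eta] multiplying the exponential is replaced by e^(u+t0); the other side is a - t = eta
   + 1 + (t0 - t). *)
have -> : eta * (1 + expR (- (u + t))) = eta + expR (t0 - t).
  by rewrite mulrDr mulr1 {2}etaV -expRD; congr (_ + expR _); ring.
have /expR_gt1Dx : t0 - t != 0 by rewrite subr_eq0 eq_sym; apply/eqP.
rewrite /t0; lra.
Qed.

(** The exponential is e^eta / (eta e^eta) = 1/eta and the second factor is 1 + eta, so the product
    is (1 + eta) / (1 + 1/eta). *)
Lemma logistic_margin_eq_interior (R : realType) (u a eta : R) :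
  0 < eta -> eta * expR eta = expR (u + a - 1) ->
  (1 + expR (- (u + (a - 1 - eta))))^-1 * (a - (a - 1 - eta)) = eta.
Proof.
move=> eta0 etaE.
have -> : - (u + (a - 1 - eta)) = eta - (u + a - 1) by ring.
rewrite expRD expRN -etaE.
have e0 := expR_gt0 eta.
by field; rewrite !gt_eqF //; nra.
Qed.

Lemma logistic_margin_lt_corner (R : realType) (u a t : R) :
  a <= 1 + expR u -> 0 < t ->
  (1 + expR (- (u + t)))^-1 * (a - t) < (1 + expR (- u))^-1 * a.
Proof.
move=> a_le t0.
rewrite opprD expRD; set q := expR (- u); set r := expR (- t).
have q0 : 0 < q := expR_gt0 _.
have r0 : 0 < r := expR_gt0 _.
have r1 : r < 1 by rewrite expR_lt1; lra.
have rt : 1 - t < r by apply: expR_gt1Dx; rewrite oppr_eq0 gt_eqF.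
have aq : a * q <= 1 + q.
  have : q * expR u = 1 by rewrite -expRD addNr expR0.
  by have := ler_wpM2r (ltW q0) a_le; lra.
have qr0 : 0 < q * r by exact: mulr_gt0.
(* Clearing denominators leaves a q (1 - r) < (1 + q) t, obtained by chaining a q <= 1 + q with 1 -
   r < t. *)
rewrite mulrC ltr_pdivrMr; last by lra.
rewrite -mulrA ltr_pdivlMl; last by lra.
have h1 : a * q * (1 - r) <= (1 + q) * (1 - r) by apply: ler_wpM2r => //; lra.
have h2 : (1 + q) * (1 - r) < (1 + q) * t by rewrite ltr_pM2l; lra.
nra.
Qed.

Theorem theorem1 (R : realType) (n m : nat) (driver : Type) (task : eqType)
  (c : task -> R)
  (alpha gamma : driver -> R)
  (B : driver -> 'rV[R]_n) (D : driver -> 'rV[R]_m)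
  (X : driver -> seq task -> 'rV[R]_n) (Y : driver -> 'rV[R]_m)
  (w : driver) (b : seq task)
  (b_uniq : uniq b)
  (c_ge0 : forall i, i \in b -> 0 <= c i)
  (X_ge0 : forall j, 0 <= X w b 0 j)
  (gamma_gt0 : 0 < gamma w) :
  let Cbar := \sum_(i <- b) c i in
  let P := acceptance_prob (alpha w) (B w) (X w b) (D w) (Y w) (gamma w) in
  let u := alpha w + dotp (B w) (X w b) + dotp (D w) (Y w) in
  argmax [set C : R | 0 <= C] (fun C => P C * (Cbar - C)) =
  [set (if gamma w * Cbar > 1 + expR u
        then - ((lambertW (expR (u + gamma w * Cbar - 1))
                 - gamma w * Cbar + 1) / gamma w)
        else 0)].
Proof.
move=> Cbar P u; set g := gamma w in gamma_gt0 *.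
have gN0 : g != 0 by rewrite gt_eqF.
(* The objective multiplied by [g], in the rescaled variable t = g C. *)
pose F t := (1 + expR (- (u + t)))^-1 * (g * Cbar - t).
have PF C C' : F (g * C) < F (g * C') -> P C * (Cbar - C) < P C' * (Cbar - C').
  by rewrite /F -!mulrBr ![_^-1 * _]mulrCA ltr_pM2l.
case: ifPn => [a_gt|]; last rewrite -leNgt => a_le.
  have [] := lambertW_spec R _ (expR_gt0 (u + g * Cbar - 1)).
  set eta := lambertW _ => eta0 etaE.
  set C0 := - _; have C0E : g * C0 = g * Cbar - 1 - eta by rewrite /C0; field.
  apply: argmax_set1 => [/=|C _ CN].
    rewrite -(pmulr_rge0 _ gamma_gt0) C0E leNgt; apply/negP => t0.
    (* Feasibility of [C0]: if it were negative, then a - 1 < eta with a = g Cbar, so the equation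
       for [eta] would give eta <= e^u < a - 1 < eta. *)
    have : expR eta * eta <= expR eta * expR u.
      by rewrite mulrC etaE -expRD ler_expR; lra.
    by rewrite ler_pM2l ?expR_gt0//; lra.
  apply: PF; rewrite {2}/F C0E logistic_margin_eq_interior//.
  apply: logistic_margin_lt_interior => //; rewrite -C0E.
  by move/(mulfI gN0).
apply: argmax_set1 => //= C C0 /eqP CN.
apply: PF; rewrite /F mulr0 subr0 addr0.
by apply: logistic_margin_lt_corner => //; rewrite mulr_gt0// lt_neqAle eq_sym CN.
Qed.
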